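(* For every domain $X$ and every $k\in\mathbb N$ there exists an $(\epsilon,\delta)$-differentially private $(\alpha,\beta)$-PAC (non-agnostic) $k$-learner for $\operatorname{POINT}_X$ with sample complexity $O\big(\tfrac{1}{\alpha\epsilon}\log(\tfrac{1}{\alpha\beta\delta})\big)$.
   Context: $\operatorname{POINT}_X=\{c_x:x\in X\}$ where $c_x(y)=1$ iff $y=x$. A $k$-labeled database of size $n$ is an element of $(X\times\{0,1\}^k)^n$. An algorithm $\mathcal A$ taking such a database and outputting $k$ hypotheses $h_1,\dots,h_k:X\to\{0,1\}$ is an $(\alpha,\beta)$-PAC $k$-learner for a concept class $C$ with sample complexity $n$ if for every distribution $\mathcal D$ over $X$ and every $c_1,\dots,c_k\in C$, given $S=((x_i,c_1(x_i),\dots,c_k(x_i)))_{i=1}^n$ with $x_i$ i.i.d. from $\mathcal D$, $\Pr[\max_j\Pr_{x\sim\mathcal D}[h_j(x)\neq c_j(x)]>\alpha]\leq\beta$ (over the sample and the coins of $\mathcal A$). Two $k$-labeled databases of the same size are neighboring if they differ in exactly one entry; $\mathcal A$ is $(\epsilon,\delta)$-differentially private if for all neighboring $S,S'$ and all output sets $T$, $\Pr[\mathcal A(S)\in T]\leq e^\epsilon\Pr[\mathcal A(S')\in T]+\delta$.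
   Formalization: The privacy parameter ε is restricted to (0,1] (for unbounded ε the claimed bound is false), α, β, δ lie in (0,1), and the sample size is bounded by the ceiling of a constant times the stated expression. *)

(* Defs.v *)
From HB Require Import structures.
From mathcomp Require Import all_boot all_order all_algebra.
From mathcomp Require Import all_classical all_reals all_analysis.

Set Implicit Arguments.
Unset Strict Implicit.
Unset Printing Implicit Defensive.

Import Order.TTheory GRing.Theory Num.Theory.
Import numFieldNormedType.Exports.

Local Open Scope classical_set_scope.
Local Open Scope ring_scope.

Section iid_sample.
Context d (X : measurableType d) (R : realType).

Definition tuple_cons n (p : X * n.-tuple X) : n.+1.-tuple X :=
  [the n.+1.-tuple X of p.1 :: p.2].

Lemma measurable_tuple_cons n : measurable_fun setT (@tuple_cons n).
Proof. by apply: measurable_cons. Qed.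

HB.instance Definition _ n :=
  isMeasurableFun.Build _ _ _ _ (@tuple_cons n) (@measurable_tuple_cons n).

(* The n-fold product D^n on n.-tuple X: D^(m+1) is the image of D \x D^m under
   (x, t) |-> x :: t. *)
Fixpoint iid (D : probability X R) (n : nat) : probability (n.-tuple X) R :=
  match n with
  | 0 => dirac [tuple]
  | m.+1 => distribution (D \x iid D m)%E (@tuple_cons m)
  end.

End iid_sample.

Section learners.
Context d (X : measurableType d) (R : realType) (n k : nat).

Definition database := n.-tuple (X * k.-tuple bool).

Definition neighboring (S S' : database) : Prop :=
  exists2 i : 'I_n, tnth S i <> tnth S' i &
    forall i' : 'I_n, i' != i -> tnth S i' = tnth S' i'.

(* Hypotheses are measurable, so that their generalization errors are
   meaningful; every set of k-tuples of hypotheses is an output event. *)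
Record algorithm := Algorithm {
  coin_disp : measure_display ;
  coin : measurableType coin_disp ;
  coin_law : probability coin R ;
  run : database -> coin -> 'I_k -> {mfun X >-> bool} ;
  measurable_output : forall (S : database) (T : set ('I_k -> {mfun X >-> bool})),
    measurable [set w | T (run S w)]
}.

Definition differentially_private (A : algorithm) (eps delta : R) : Prop :=
  forall S S' : database, neighboring S S' ->
  forall T : set ('I_k -> {mfun X >-> bool}),
    (coin_law A [set w | T (run S w)]
      <= (expR eps)%:E * coin_law A [set w | T (run S' w)] + delta%:E)%E.

Definition label (c : 'I_k -> X -> bool) (x : n.-tuple X) : database :=
  [tuple of [seq (y, [tuple c j y | j < k]) | y <- x]].

Definition error (D : probability X R) (h c : X -> bool) : \bar R :=
  D [set x | h x <> c x].

Definition failure (A : algorithm) (alpha : R) (D : probability X R)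
    (c : 'I_k -> X -> bool) : set (n.-tuple X * coin A) :=
  [set z | (alpha%:E <
    \big[maxe/0%E]_(j < k) error D (run (label c z.1) z.2 j) (c j))%E].

(* Measurability of the failure event is part of being a learner: otherwise its
   probability is not defined. *)
Definition PAC_learner (C : set (X -> bool)) (A : algorithm) (alpha beta : R)
    : Prop :=
  forall (D : probability X R) (c : 'I_k -> X -> bool), (forall j, C (c j)) ->
    measurable (failure (A := A) alpha D c) /\
    ((iid D n \x coin_law A) (failure (A := A) alpha D c) <= beta%:E)%E.

End learners.

Definition POINT d (X : measurableType d) : set (X -> bool) :=
  [set c | exists x : X, c = (fun y => y == x)].

(* The rounding up only matters when the real bound is below 1, as happens when
   alpha, beta and delta are all close to 1; a sample size is an integer, and one
   sample is needed there. *)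
Definition sample_bound (R : realType) (C alpha beta eps delta : R) : int :=
  Num.ceil (C * ((alpha * eps)^-1 * ln (alpha * beta * delta)^-1)).

(* Main.v *)
Require Import Defs.
From HB Require Import structures.
From mathcomp Require Import all_boot all_order all_algebra.
From mathcomp Require Import all_classical all_reals all_analysis.
From mathcomp Require Import measurable_realfun.
From mathcomp Require Import ring lra.

Set Implicit Arguments.
Unset Strict Implicit.
Unset Printing Implicit Defensive.

Import Order.TTheory GRing.Theory Num.Theory.
Local Open Scope classical_set_scope.
Local Open Scope ring_scope.

(** The learner is a stable histogram whose bins are whole labeled points
    (x, y) with y in {0,1}^k, so that replacing one entry changes only two bin
    counts, whatever k is.  A bin of count m is released with probability p m,
    where p 0 = 0, independently of the other bins, and h_j is the union of the
    points released with j-th label 1.  On a consistently labeled sample h_j can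
    only err by missing the point x_j of c_j, and this matters only if
    D{x_j} > alpha; there are at most 1/alpha such points.

    If p is logistic with rate eps/2, cut off at 0, and p 1 <= delta/3, then each
    count change costs (eps/2, delta/3).  Moreover 1 - p m <= K r^m with
    r = e^(-eps/2) and K = O(1/delta), and the mean of r^m for a binomial m is
    (1 - (1 - r) D{x})^n, so no tail bound is needed.

    When alpha beta delta is close to 1 the sample bound only allows n = 1; then
    the sample is released with probability delta. *)

(** * Random sublists with independent inclusions *)

Section sublist_mean.
Context (R : realType) (B : eqType).
Implicit Types (q : B -> R) (s : seq B) (f : seq B -> R).

(* The mean of f over the random sublist of s that keeps each b independently
   with probability q b. *)
Fixpoint sublist_mean q s f : R :=
  if s is b :: s' then
    q b * sublist_mean q s' (f \o cons b) + (1 - q b) * sublist_mean q s' f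
  else f [::].

(** Output events of the learner depend only on the set of released bins, which lets bins be
    reordered. *)
Definition set_invariant f := forall s s', s =i s' -> f s = f s'.

Lemma set_invariant_cons f b : set_invariant f -> set_invariant (f \o cons b).
Proof. by move=> fS s s' ss'; apply: fS => x; rewrite !inE ss'. Qed.

Lemma eq_sublist_mean q s f f' : f =1 f' -> sublist_mean q s f = sublist_mean q s f'.
Proof.
elim: s f f' => [|b s IH] f f' ff' //=.
by rewrite (IH _ _ ff') (IH _ (f' \o cons b)) // => x; apply: ff'.
Qed.

Lemma sublist_mean_rem q s f b : set_invariant f -> b \in s ->
  sublist_mean q s f = sublist_mean q (b :: rem b s) f.
Proof.
elim: s f => [|a s IH] f fS //=; rewrite inE.
have [->|ab /= bs] := eqVneq b a; first by [].
rewrite (IH _ fS bs) (IH _ (set_invariant_cons a fS) bs) /=.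
rewrite (@eq_sublist_mean _ _ ((f \o cons a) \o cons b) ((f \o cons b) \o cons a)).
  by ring.
by move=> x /=; apply: fS => y; rewrite !inE orbCA.
Qed.

Lemma sublist_mean_perm q s s' f : set_invariant f -> perm_eq s s' ->
  sublist_mean q s f = sublist_mean q s' f.
Proof.
elim: s s' f => [|a s IH] s' f fS pss'.
  by move: pss'; rewrite perm_sym => /perm_nilP ->.
have as' : a \in s' by rewrite -(perm_mem pss') mem_head.
rewrite (sublist_mean_rem q fS as') /=.
have pr : perm_eq s (rem a s').
  by rewrite -(perm_cons a) (perm_trans pss') // perm_to_rem.
by rewrite (IH _ _ fS pr) (IH _ _ (set_invariant_cons a fS) pr).
Qed.

Lemma sublist_mean_filter q s f :
  sublist_mean q s f = sublist_mean q [seq b <- s | q b != 0] f.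
Proof.
elim: s f => [|b s IH] f //=.
have [-> /=|_ /=] := eqVneq (q b) 0.
  by rewrite mul0r add0r subr0 mul1r.
by rewrite -!IH.
Qed.

(** Elements of probability 0 are never kept. This lets two databases be compared over one common
    list of bins. *)
Lemma sublist_mean_support q s s' f : set_invariant f -> uniq s -> uniq s' ->
    (forall b, q b != 0 -> (b \in s) = (b \in s')) ->
  sublist_mean q s f = sublist_mean q s' f.
Proof.
move=> fS us us' ss'; rewrite sublist_mean_filter [RHS]sublist_mean_filter.
apply: sublist_mean_perm => //; apply: uniq_perm; rewrite ?filter_uniq//.
move=> b; rewrite !mem_filter; case: (boolP (q b != 0)) => //= qb.
exact: ss'.
Qed.

Lemma sublist_mean01 q s f : (forall b, 0 <= q b <= 1) ->
  (forall t, 0 <= f t <= 1) -> 0 <= sublist_mean q s f <= 1.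
Proof.
move=> q01; elim: s f => [|b s IH] f f01 //=.
have /andP[x0 x1] := IH f f01.
have /andP[y0 y1] := IH (f \o cons b) (fun t => f01 (b :: t)).
have /andP[qb0 qb1] := q01 b; nra.
Qed.

Lemma eq_sublist_meanl q q' s f : {in s, q =1 q'} ->
  sublist_mean q s f = sublist_mean q' s f.
Proof.
elim: s f => [|b s IH] f qq' //=.
by rewrite qq' ?mem_head// !IH// => x xs; apply: qq'; rewrite inE xs orbT.
Qed.

Lemma sublist_mean_cst q s c : sublist_mean q s (fun=> c) = c.
Proof. by elim: s => //= a s IH; rewrite /comp IH; ring. Qed.

Lemma sublist_mean_le q s f f' : (forall b, 0 <= q b <= 1) ->
  (forall t, f t <= f' t) -> sublist_mean q s f <= sublist_mean q s f'.
Proof.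
move=> q01; elim: s f f' => [|b s IH] f f' ff' //=.
have /andP[q0 q1] := q01 b.
by rewrite lerD ?ler_wpM2l ?subr_ge0 ?IH// => t; apply: ff'.
Qed.

Lemma sublist_mean_sum (I : Type) (r : seq I) q s (F : I -> seq B -> R) :
  sublist_mean q s (fun t => \sum_(i <- r) F i t) =
  \sum_(i <- r) sublist_mean q s (F i).
Proof.
elim: s F => [|b s IH] F //=.
rewrite (IH (fun i => F i \o cons b)) IH !mulr_sumr -big_split.
exact: eq_bigr.
Qed.

Lemma sublist_mean_notin q s b : uniq s ->
  sublist_mean q s (fun t => (b \notin t)%:R) = if b \in s then 1 - q b else 1.
Proof.
elim: s => [|a s IH] //= /andP[as_ us]; rewrite inE IH//.
have [->|ba] /= := eqVneq b a.
  rewrite (@eq_sublist_mean q s _ (fun=> 0)) ?sublist_mean_cst ?(negbTE as_).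
    by ring.
  by move=> t /=; rewrite mem_head.
rewrite (@eq_sublist_mean q s (_ \o _) (fun t => (b \notin t)%:R)) ?IH.
- by case: ifP => _; ring.
- by [].
by move=> t /=; rewrite inE (negbTE ba).
Qed.

(* (rho, delta)-closeness of two Bernoulli laws: the two nontrivial events
   suffice. *)
Definition bernoulli_close (rho delta a b : R) :=
  a <= rho * b + delta /\ 1 - a <= rho * (1 - b) + delta.

(** The mixture is y + a (x - y): for y <= x the first closeness inequality applies, otherwise the
    second, with the roles exchanged. Since |x - y| <= 1, delta does not grow. *)
Lemma bernoulli_close_mix rho delta a b x y : 1 <= rho -> 0 <= delta ->
    0 <= a <= 1 -> 0 <= b <= 1 -> 0 <= x <= 1 -> 0 <= y <= 1 ->
    bernoulli_close rho delta a b ->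
  a * x + (1 - a) * y <= rho * (b * x + (1 - b) * y) + delta.
Proof.
move=> rho1 d0 /andP[a0 a1] /andP[b0 b1] /andP[x0 x1] /andP[y0 y1] [c1 c2].
have [xy|/ltW yx] := leP y x.
  have h1 : a * (x - y) <= (rho * b + delta) * (x - y) by rewrite ler_wpM2r ?subr_ge0.
  have h2 : delta * (x - y) <= delta * 1 by rewrite ler_wpM2l//; lra.
  have h3 : 1 * y <= rho * y by rewrite ler_wpM2r.
  nra.
have h1 : (1 - a) * (y - x) <= (rho * (1 - b) + delta) * (y - x).
  by rewrite ler_wpM2r ?subr_ge0.
have h2 : delta * (y - x) <= delta * 1 by rewrite ler_wpM2l//; lra.
have h3 : 1 * x <= rho * x by rewrite ler_wpM2r.
nra.
Qed.

(** Only the choice at [e] differs, and it occurs at most once in [s]. Elsewhere both sides are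
    mixed with equal weights, so delta is paid only once. *)
Lemma sublist_mean_close rho delta q q' e s f : 1 <= rho -> 0 <= delta ->
    (forall b, 0 <= q b <= 1) -> (forall b, 0 <= q' b <= 1) ->
    (forall t, 0 <= f t <= 1) -> uniq s ->
    (forall b, b != e -> q b = q' b) -> bernoulli_close rho delta (q e) (q' e) ->
  sublist_mean q s f <= rho * sublist_mean q' s f + delta.
Proof.
move=> rho1 d0 q01 q'01 f01 us qq' cl.
elim: s f f01 us => [|b s IH] f f01 /=.
  by move=> _; have /andP[? ?] := f01 [::]; nra.
move=> /andP[bs us].
have f'01 t : 0 <= (f \o cons b) t <= 1 by apply: f01.
have [be|be] := eqVneq b e.
  have ss' g : sublist_mean q s g = sublist_mean q' s g.
    apply: eq_sublist_meanl => x xs; apply: qq'.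
    by apply: contraNneq bs; rewrite be => <-.
  rewrite !ss'; apply: bernoulli_close_mix; rewrite ?be//.
    by apply: sublist_mean01 => // t; rewrite -be.
  exact: sublist_mean01.
rewrite (qq' _ be).
have h1 := IH _ f01 us; have h2 := IH _ f'01 us.
have /andP[a0 a1] := q'01 b.
set x := sublist_mean q s f in h1 *; set y := sublist_mean q s _ in h2 *.
set x' := sublist_mean q' s f in h1 *; set y' := sublist_mean q' s _ in h2 *.
nra.
Qed.

End sublist_mean.

(** * Finite coins realizing the independent releases *)

Section coins.
Context (R : realType) (N : nat) (p : nat -> R) (B : eqType).
Implicit Types (g : B -> nat) (s : seq B).

Fixpoint coins m : finType :=
  if m is m'.+1 then ('I_N.+1 * coins m')%type : finType else unit.

(* A coin falls below j with probability p j, for j <= N. *)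
Definition level (v : 'I_N.+1) : R :=
  if (v < N)%N then p v.+1 - p v else 1 - p N.

Fixpoint weight m : coins m -> R :=
  if m is m'.+1 then fun w => level w.1 * weight w.2 else fun=> 1.

(* Each bin uses the coin at the position of its last occurrence, so that
   distinct bins use independent coins. *)
Fixpoint release g m : seq B -> coins m -> seq B :=
  if m is m'.+1 then
    fun s w => if s is b :: s' then
      if (b \notin s') && (w.1 < g b)%N then b :: release g s' w.2
      else release g s' w.2
    else [::]
  else fun _ _ => [::].

Fixpoint default_coins m : coins m :=
  if m is m'.+1 then (ord0, default_coins m') else tt.

Lemma release_sub g m s (w : coins m) : {subset release g s w <= s}.
Proof.
elim: m s w => [|m IH] [|b s] w x //=.
case: ifP => _; rewrite !inE; last by move=> /IH ->; rewrite orbT.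
by case/orP => [->//|/IH ->]; rewrite orbT.
Qed.

(** The release of [z] depends only on [g z] and on the positions of [z]; measurability of the
    failure event rests on this. *)
Lemma mem_release_eq g g' m s s' (w : coins m) z z' : g z = g' z' ->
    [seq b == z | b <- s] = [seq b == z' | b <- s'] ->
  (z \in release g s w) = (z' \in release g' s' w).
Proof.
move=> gz; elim: m s s' w => [|m IH] [|b s] [|b' s'] w //= [] bz ss'.
have ms : (z \in s) = (z' \in s').
  by rewrite -!has_pred1 -(has_map (pred1 z) id) ss' has_map.
have -> t b0 y (c : bool) : (y \in if c then b0 :: t else t) = (c && (b0 == y)) || (y \in t).
  by case: c; rewrite ?inE// eq_sym.
have -> t b0 y (c : bool) : (y \in if c then b0 :: t else t) = (c && (b0 == y)) || (y \in t).
  by case: c; rewrite ?inE// eq_sym.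
rewrite (IH _ _ _ ss') -bz; case: (eqVneq b z) bz => [->|_ _]; last by rewrite !andbF.
by move=> /esym/eqP ->; rewrite ms gz.
Qed.

Hypothesis p0 : p 0 = 0.
Hypothesis p_mono : {homo p : i j / (i <= j)%N >-> i <= j}.
Hypothesis p_le1 : forall i, p i <= 1.

Lemma level_ge0 v : 0 <= level v.
Proof. by rewrite /level; case: ifP => _; rewrite subr_ge0 ?p_le1// p_mono. Qed.

Lemma weight_ge0 m (w : coins m) : 0 <= weight w.
Proof. by elim: m w => //= m IH w; rewrite mulr_ge0 ?level_ge0. Qed.

Lemma level_mean j x y : (j <= N)%N ->
  \sum_v level v * (if (v < j)%N then x else y) = p j * x + (1 - p j) * y.
Proof.
move=> jN; rewrite big_ord_recr /= {2}/level ltnn ltnNge jN /=.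
rewrite (eq_bigr (fun v : 'I_N => (p v.+1 - p v) * (if (v < j)%N then x else y))); last first.
  by move=> i _; rewrite /level /= ltn_ord.
rewrite -(big_mkord xpredT (fun v => (p v.+1 - p v) * (if (v < j)%N then x else y))).
rewrite (big_cat_nat _ jN)//=.
under eq_big_nat => v /andP[_ vj] do rewrite vj.
under [X in _ + X + _]eq_big_nat => v /andP[jv _] do rewrite ltnNge jv /=.
by rewrite -!mulr_suml !telescope_sumr// p0; ring.
Qed.

Lemma level_sum : \sum_v level v = 1.
Proof.
have := @level_mean 0 1 1 (leq0n _); rewrite p0 mul0r add0r subr0 mulr1 => <-.
by apply: eq_bigr => v _; rewrite mulr1.
Qed.

Lemma release_law m g s f : size s = m -> (forall b, (g b <= N)%N) ->
  \sum_(w : coins m) weight w * f (release g s w) =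
  sublist_mean (p \o g) (undup s) f.
Proof.
move=> <- gN; elim: s f => [|b s IH] f /=.
  by rewrite (big_pred1 tt) ?mul1r// => -[].
pose h (v : 'I_N.+1) (w : coins (size s)) := level v * weight w *
  f (if (b \notin s) && (v < g b)%N then b :: release g s w else release g s w).
rewrite (eq_bigr (fun w => h w.1 w.2)) // -(pair_bigA _ h) /= exchange_big /h /=.
case: (boolP (b \in s)) => /= bs.
  rewrite -IH; apply: eq_bigr => w _; rewrite -mulr_suml -mulr_suml.
  by rewrite level_sum mul1r.
rewrite -!IH !mulr_sumr -big_split /=; apply: eq_bigr => w _.
rewrite mulrCA [X in _ = _ + X]mulrCA -mulrDr -level_mean// mulr_sumr.
by apply: eq_bigr => v _; case: ifP => _; rewrite -!mulrA; ring.
Qed.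

Lemma weight_sum m : \sum_(w : coins m) weight w = 1.
Proof.
elim: m => [|m IH] /=; first by rewrite (big_pred1 tt)// => -[].
rewrite -(pair_bigA _ (fun v w => level v * weight w)) /= -level_sum.
by apply: eq_bigr => v _; rewrite -mulr_sumr IH mulr1.
Qed.

End coins.

(** * Finite laws coded as probabilities on the naturals *)

Section finite_law.
Context (R : realType) (W : finType) (w0 : W) (a : W -> R).
Hypotheses (a_ge0 : forall w, 0 <= a w) (a_sum : \sum_w a w = 1).

Definition decode (i : nat) : W := nth w0 (enum W) i.

(* Coins are coded by naturals because every set of naturals is measurable.  The
   normalization a_sum is an argument so that it can be recovered when finite_law
   is inferred to be a probability. *)
Definition finite_law of \sum_w a w = 1 : set nat -> \bar R :=
  msum (fun i => mscale (NngNum (a_ge0 (decode i))) (dirac i)) #|W|.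

HB.instance Definition _ := Measure.copy (finite_law a_sum)
  (msum (fun i => mscale (NngNum (a_ge0 (decode i))) (dirac i)) #|W|).

Lemma finite_lawE (A : set W) :
  finite_law a_sum (decode @^-1` A) = (\sum_w a w * `[< A w >]%:R)%:E.
Proof.
rewrite -big_enum (big_nth w0) -cardE big_mkord -sumEFin; apply: eq_bigr => i _.
by rewrite /= /mscale /= diracE EFinM.
Qed.

Let finite_law_setT : finite_law a_sum setT = 1%E.
Proof.
rewrite -(preimage_setT decode) finite_lawE; congr (_%:E); rewrite -[RHS]a_sum.
by apply: eq_bigr => w _; rewrite asboolT ?mulr1.
Qed.

HB.instance Definition _ :=
  Measure_isProbability.Build _ _ _ (finite_law a_sum) finite_law_setT.

End finite_law.

(** * The histogram learner and its privacy *)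

Lemma measurable_eq_point d (X : measurableType d) (z : X) :
  measurable [set z] -> measurable_fun setT (fun y : X => y == z).
Proof.
move=> mz; apply: (measurable_fun_bool true); rewrite setTI.
rewrite (_ : _ @^-1` _ = [set z])//.
by apply/seteqP; split => y /= => [/eqP|->]; rewrite ?eqxx.
Qed.

Section histogram.
Context d (X : measurableType d) (R : realType) (n k : nat).
Hypothesis measurable_singleton : forall x : X, measurable [set x].
Notation bin := (X * k.-tuple bool)%type.
Implicit Types (L : seq bin) (S : database X n k).

Definition covers L (j : 'I_k) (x : X) : bool :=
  has (fun b => (x == b.1) && tnth b.2 j) L.

Lemma measurable_covers L j : measurable_fun setT (covers L j).
Proof.
elim: L => [|b L IH]; first exact: measurable_cst.
apply: measurable_or => //; apply: measurable_and; last exact: measurable_cst.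
exact: measurable_eq_point.
Qed.

HB.instance Definition _ L j :=
  isMeasurableFun.Build _ _ _ _ (covers L j) (measurable_covers L j).

Definition hypotheses L : 'I_k -> {mfun X >-> bool} := fun j => covers L j.

Lemma eq_hypotheses L L' : L =i L' -> hypotheses L = hypotheses L'.
Proof.
move=> LL'; apply/funext => j; apply/mfuneqP => x /=.
exact: eq_has_r.
Qed.

Context (p : nat -> R).
Hypothesis p0 : p 0 = 0.
Hypothesis p_mono : {homo p : i j / (i <= j)%N >-> i <= j}.
Hypothesis p_le1 : forall i, p i <= 1.

Definition multiplicity S (b : bin) : nat := count_mem b S.

Lemma multiplicity_le S b : (multiplicity S b <= n)%N.
Proof. by rewrite -[leqRHS](size_tuple S) count_size. Qed.

Definition histogram_law : probability nat R :=
  finite_law (default_coins n n) (@weight_ge0 _ n p p_mono p_le1 n)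
    (weight_sum n p0 n).

Definition released S (i : nat) : seq bin :=
  release (multiplicity S) S (decode (default_coins n n) i).

Definition histogram : algorithm X R n k :=
  @Algorithm _ X R n k _ nat histogram_law (fun S i => hypotheses (released S i))
    (fun _ _ => I).

Lemma histogram_lawE S (A : set (seq bin)) :
  histogram_law [set i | A (released S i)] =
  (sublist_mean (p \o multiplicity S) (undup S) (fun L => `[< A L >]%:R))%:E.
Proof.
rewrite -(release_law (N := n) p0 (m := n)) ?size_tuple//; last first.
  exact: multiplicity_le.
exact: (@finite_lawE _ _ _ _ _ _ [set w | A (release (multiplicity S) S w)]).
Qed.

Lemma p01 i : 0 <= p i <= 1.
Proof. by rewrite p_le1 andbT -p0 p_mono. Qed.

Lemma run_lawE S (T : set ('I_k -> {mfun X >-> bool})) :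
  coin_law histogram [set w | T (run S w)] =
  (sublist_mean (p \o multiplicity S) (undup S)
     (fun L => `[< T (hypotheses L) >]%:R))%:E.
Proof. exact: (histogram_lawE S [set L | T (hypotheses L)]). Qed.

(* The hybrid q below changes the multiplicity of the new bin but not yet that
   of the old one. *)
Lemma histogram_private rho delta0 eps delta :
    1 <= rho -> 0 <= delta0 ->
    (forall i, p i.+1 <= rho * p i + delta0) ->
    (forall i, 1 - p i <= rho * (1 - p i.+1) + delta0) ->
    rho * rho <= expR eps -> (1 + rho) * delta0 <= delta ->
  differentially_private histogram eps delta.
Proof.
move=> rho1 d0 pS pSC rho_eps rho_delta S S' [i Si SiC] T.
rewrite !run_lawE -EFinM -EFinD lee_fin.
set f := fun L => _.
have fS : set_invariant f by move=> L L' LL'; rewrite /f (eq_hypotheses LL').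
have f01 L : 0 <= f L <= 1 by rewrite /f ler0n lern1 leq_b1.
set e := tnth S i in Si *; set e' := tnth S' i in Si *.
have multE (Q : database X n k) b : multiplicity Q b =
    ((tnth Q i == b) + \sum_(j < n | j != i) (tnth Q j == b))%N.
  by rewrite /multiplicity -sum1_count big_mkcond big_tuple (bigD1 i)//=.
have rest b : (\sum_(j < n | j != i) (tnth S j == b) =
    \sum_(j < n | j != i) (tnth S' j == b))%N.
  by apply: eq_bigr => j /SiC ->.
have ee' : e == e' = false by apply/eqP.
have meS : multiplicity S e = (multiplicity S' e).+1.
  by rewrite !multE rest -/e -/e' eqxx eq_sym ee'.
have meS' : multiplicity S' e' = (multiplicity S e').+1.
  by rewrite !multE rest -/e -/e' eqxx ee'.
have mC b : b != e -> b != e' -> multiplicity S b = multiplicity S' b.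
  by rewrite !multE rest -/e -/e' !(eq_sym b) => /negbTE -> /negbTE ->.
(* A bin outside a database has count 0 and release probability p 0 = 0, so both means may run over
   the bins of either database. *)
pose U := undup (S ++ S').
have toU (Q : database X n k) : {subset Q <= U} ->
    sublist_mean (p \o multiplicity Q) (undup Q) f =
    sublist_mean (p \o multiplicity Q) U f.
  move=> QU; apply: sublist_mean_support; rewrite ?undup_uniq// => b.
  rewrite mem_undup; case: (boolP (b \in Q)) => [/QU -> //|bQ] /=.
  by rewrite /multiplicity (count_memPn bQ) p0 eqxx.
rewrite !toU; [|by move=> b bS; rewrite mem_undup mem_cat bS ?orbT..].
pose q b := if b == e' then p (multiplicity S' b) else p (multiplicity S b).
have q01 b : 0 <= q b <= 1 by rewrite /q; case: ifP => _; exact: p01.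
have close_le a b : a <= b -> 0 <= a <= 1 -> 0 <= b <= 1 -> b <= rho * a + delta0 ->
    1 - a <= rho * (1 - b) + delta0 ->
    bernoulli_close rho delta0 a b /\ bernoulli_close rho delta0 b a.
  by move=> ab /andP[? ?] /andP[? ?] ? ?; split; split; nra.
have step1 : sublist_mean (p \o multiplicity S) U f <= rho * sublist_mean q U f + delta0.
  apply: (@sublist_mean_close _ _ _ _ _ _ e') => //.
  - by move=> b; exact: p01.
  - exact: undup_uniq.
  - by move=> b be'; rewrite /q (negbTE be').
  by rewrite /q eqxx /= meS'; apply: (close_le _ _ _ (p01 _) (p01 _) _ _).1; rewrite ?p_mono.
have step2 : sublist_mean q U f <= rho * sublist_mean (p \o multiplicity S') U f + delta0.
  apply: (@sublist_mean_close _ _ _ _ _ _ e) => //.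
  - by move=> b; exact: p01.
  - exact: undup_uniq.
  - by move=> b be; rewrite /q /=; case: eqP => // /eqP be'; rewrite mC.
  rewrite /q ee' /= meS.
  by apply: (close_le _ _ _ (p01 _) (p01 _) _ _).2; rewrite ?p_mono.
(* Nonnegativity allows rho * rho to be replaced by exp eps once the two steps are composed; the
   additive losses are delta0 and rho * delta0. *)
have /andP[m0 _] : 0 <= sublist_mean (p \o multiplicity S') U f <= 1.
  by apply: sublist_mean01 => // b; exact: p01.
nra.
Qed.

(* With a single sample the two output laws differ only where the sample is
   released, which happens with probability p 1. *)
Lemma histogram_private1 eps delta : n = 1 -> 0 <= eps -> p 1 <= delta ->
  differentially_private histogram eps delta.
Proof.
move=> n1 eps0 p1 S S' _ T; rewrite !run_lawE -EFinM -EFinD lee_fin.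
set f := fun L => _.
have f01 L : 0 <= f L <= 1 by rewrite /f ler0n lern1 leq_b1.
have meanE (Q : database X n k) : exists e,
    sublist_mean (p \o multiplicity Q) (undup Q) f = p 1 * f [:: e] + (1 - p 1) * f [::].
  have : size Q = 1 by rewrite size_tuple.
  rewrite /multiplicity.
  case: (tval Q) => [|e [|//]] //= _.
  by exists e; rewrite eqxx.
have [[e ->] [e' ->]] := (meanE S, meanE S').
have /andP[? ?] := f01 [:: e]; have /andP[? ?] := f01 [:: e'].
have /andP[? ?] := f01 [::]; have /andP[? ?] := p01 1.
have : 1 <= expR eps by have := expR_ge1Dx eps; lra.
move=> x1; have m0 : 0 <= p 1 * f [:: e'] + (1 - p 1) * f [::] by nra.
have := ler_wpM2r m0 x1; nra.
Qed.

End histogram.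

(** * Occurrences of a point in an i.i.d. sample *)

Lemma count_mem_map (T : eqType) (z : T) s :
  count_mem z s = count id [seq y == z | y <- s].
Proof. by rewrite count_map. Qed.

Section occurrences.
Context d (X : measurableType d) (R : realType).
Hypothesis measurable_singleton : forall x : X, measurable [set x].
Implicit Types (D : probability X R) (z : X).

(** Such an event is a finite union, over patterns of occurrences of [z], of finite intersections of
    conditions on single coordinates. *)
Lemma measurable_occurrences n z (P : set (n.-tuple X)) :
    (forall x x' : n.-tuple X, [seq y == z | y <- x] = [seq y == z | y <- x'] -> P x -> P x') ->
  measurable P.
Proof.
move=> Pz; pose bits (x : n.-tuple X) : n.-tuple bool := [tuple of [seq y == z | y <- x]].
pose Q : set (n.-tuple bool) := [set t | exists2 x, P x & bits x = t].
have -> : P = \bigcup_(t in Q) \bigcap_(i in [set: 'I_n])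
    (@tnth n X ^~ i) @^-1` [set y | (y == z) = tnth t i].
  apply/seteqP; split => [x Px|x [_ [x' Px' <-] xx']].
    by exists (bits x); [exists x | move=> i _ /=; rewrite tnth_map].
  apply: (Pz x') => //; suff /(congr1 val) : bits x' = bits x by [].
  by apply: eq_from_tnth => i; rewrite -(xx' i I) tnth_map.
apply: fin_bigcup_measurable => [|t _]; first exact: finite_finset.
apply: fin_bigcap_measurable => [|i _]; first exact: finite_finset.
rewrite -[X in measurable X]setTI; apply: measurable_tnth => //.
rewrite -[X in measurable X]setTI.
exact: (measurable_eq_point (measurable_singleton z) measurableT (Y := [set tnth t i])).
Qed.

Lemma set_seq_cons y (s : seq X) : [set` y :: s] = [set y] `|` [set` s].
Proof.
apply/seteqP; split => x /=; rewrite inE; first by move=> /predU1P.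
by move=> ?; apply/predU1P.
Qed.

Lemma measurable_set_seq (s : seq X) : measurable [set` s].
Proof.
elim: s => [|y s IH]; first by rewrite set_nil.
by rewrite set_seq_cons; exact: measurableU.
Qed.

Lemma sum_probability_singletons D (s : seq X) : uniq s ->
  (\sum_(y <- s) D [set y] <= 1)%E.
Proof.
move=> us; rewrite (_ : (\sum_(y <- s) D [set y])%E = D [set` s]).
  exact/probability_le1/measurable_set_seq.
elim: s us => [|y s IH] /=; first by rewrite big_nil set_nil measure0.
move=> /andP[ys us]; rewrite big_cons IH// set_seq_cons measureU//.
- exact: measurable_set_seq.
- by apply/seteqP; split => x //= -[->]; apply/negP.
Qed.

Lemma measurable_count n z (f : nat -> \bar R) :
  measurable_fun [set: n.-tuple X] (fun x => f (count_mem z x)).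
Proof.
move=> _ Y mY; rewrite setTI; apply: (@measurable_occurrences _ z) => x x' xx' /=.
by rewrite !count_mem_map xx'.
Qed.

(** This is the generating function of a binomial count: Tonelli peels off one entry at a time, each
    a factor of mean 1 - (1 - r) D{z}. *)
Lemma integral_power_occurrences D z n (r : R) : 0 <= r <= 1 ->
  (\int[iid D n]_x (r ^+ count_mem z x)%:E =
   ((1 - (1 - r) * fine (D [set z])) ^+ n)%:E)%E.
Proof.
move=> /andP[r0 r1].
have mF m := @measurable_count m z (fun i => (r ^+ i)%:E).
have F0 i : (0 <= (r ^+ i)%:E)%E by rewrite lee_fin exprn_ge0.
elim: n => [|n IH].
  rewrite /= integral_dirac//; last exact: (mF 0).
  by rewrite diracE in_setT mul1e expr0.
have mz : measurable_fun [set: X] (fun y => (r ^+ (y == z))%:E).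
  apply: (measurableT_comp (f := fun b : bool => (r ^+ b)%:E : \bar R)) => //.
  exact: measurable_eq_point.
transitivity (\int[D]_y ((r ^+ (y == z))%:E * (((1 - (1 - r) * fine (D [set z])) ^+ n)%:E)))%E.
  rewrite [LHS]ge0_integral_distribution//=; last exact: (mF n.+1).
  rewrite fubini_tonelli1//=; last first.
    exact: (measurableT_comp (mF n.+1) (@measurable_tuple_cons _ X n)).
  apply: eq_integral => y _; rewrite -IH -ge0_integralZl//; last exact: (mF n).
  by apply: eq_integral => x _; rewrite /= -EFinM -exprD.
rewrite ge0_integralZr//=; last first.
  by rewrite -IH; apply: integral_ge0.
rewrite exprS EFinM; congr (_ * _)%E.
have -> : (fun y : X => (r ^+ (y == z))%:E) =
    (fun y => r%:E * (\1_[set z] y)%:E + (\1_(~` [set z]) y)%:E)%E.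
  apply/funext => y; rewrite !indicE in_setC.
  case: (eqVneq y z) => [->|yz].
    by rewrite mem_set// mule1 adde0 expr1.
  by rewrite memNset ?mule0 ?add0e ?expr0//; apply/eqP.
have mI (A : set X) : measurable A -> measurable_fun setT (fun y => (\1_A y)%:E : \bar R).
  by move=> mA; exact/measurable_EFinP/measurable_indic.
have mzC : measurable (~` [set z]) by exact: measurableC.
rewrite ge0_integralD//=.
- rewrite ge0_integralZl//; last exact: mI.
  rewrite !integral_indic// !setIT.
  transitivity (r%:E * D [set z] + (1 - D [set z]))%E.
    by congr (_ + _)%E; exact: probability_setC.
  rewrite -(fineK (fin_num_measure D _ (measurable_singleton z))).
  by rewrite -EFinM -EFinB -EFinD; congr (_%:E); rewrite /=; ring.
- by move=> y _; rewrite mule_ge0.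
- by apply: measurable_funeM; exact: mI.
- exact: mI.
Qed.

End occurrences.

(** * Accuracy on point concepts *)

Section accuracy.
Context d (X : measurableType d) (R : realType) (n k : nat).
Hypothesis measurable_singleton : forall x : X, measurable [set x].
Context (p : nat -> R).
Hypothesis p0 : p 0 = 0.
Hypothesis p_mono : {homo p : i j / (i <= j)%N >-> i <= j}.
Hypothesis p_le1 : forall i, p i <= 1.
Context (D : probability X R) (z : 'I_k -> X).

Let c (j : 'I_k) (y : X) := y == z j.
Let bin (y : X) : X * k.-tuple bool := (y, [tuple c j y | j < k]).
Let A := histogram n k measurable_singleton p0 p_mono p_le1.

Let bin_inj : injective bin. Proof. by move=> y y' []. Qed.

Let missed (x : n.-tuple X) (i : nat) (j : 'I_k) : bool :=
  bin (z j) \notin released (label c x) i.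

(** Several concepts may share a point; without duplicates the length is at most 1/alpha whatever
    [k] is. *)
Let heavy (alpha : R) : seq X :=
  undup [seq z j | j <- enum 'I_k & (alpha%:E < D [set z j])%E].

Let binE (x : n.-tuple X) y : [seq b == bin y | b <- label c x] = [seq y' == y | y' <- x].
Proof. by rewrite /= -map_comp; apply: eq_map => y' /=; rewrite -(inj_eq bin_inj). Qed.

Let multiplicity_label (x : n.-tuple X) y : multiplicity (label c x) (bin y) = count_mem y x.
Proof.
by rewrite /multiplicity count_mem_map binE -count_mem_map.
Qed.

(** Bins of [L] carry correct labels, so a hypothesis is never 1 where its concept is 0; the only
    possible error is at [z j]. *)
Lemma error_covers L j : (forall b, b \in L -> b = bin b.1) ->
  error D (covers L j) (c j) = if bin (z j) \in L then 0%E else D [set z j].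
Proof.
move=> Lbin; have coversE y : covers L j y = (bin (z j) \in L) && c j y.
  apply/hasP/andP => [[b bL /andP[/eqP ->]]|[zL /eqP ->]].
    rewrite {1}(Lbin _ bL) tnth_mktuple => cb; split => //.
    by rewrite -(eqP cb) -(Lbin _ bL).
  by exists (bin (z j)); rewrite //= tnth_mktuple /c !eqxx.
rewrite /error; case: ifPn => zL.
  rewrite (_ : mkset _ = set0) ?measure0//.
  by apply/seteqP; split => y //=; rewrite coversE zL.
congr (D _); apply/seteqP; split => y /=; rewrite coversE (negbTE zL) /c.
  by case: eqP.
by move=> ->; rewrite eqxx.
Qed.

Lemma error_run x i j : error D (run (a := A) (label c x) i j) (c j) =
  if missed x i j then D [set z j] else 0%E.
Proof.
rewrite if_neg; apply: error_covers => b /release_sub /mapP[y _ ->] //.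
Qed.

(** An error exceeds alpha only by missing a point of mass above alpha. The maximum starts from 0,
    hence 0 <= alpha. *)
Lemma failureE alpha : 0 <= alpha -> failure (A := A) alpha D c =
  [set u | [exists j, (alpha%:E < D [set z j])%E && missed u.1 u.2 j]].
Proof.
move=> alpha0; rewrite /failure; apply/seteqP; split => -[x i] /=.
  rewrite ltNge => /negP nle; apply: contrapT => /negP; rewrite negb_exists.
  move=> /forallP Hj; apply: nle; apply/bigmax_leP; split; first by rewrite lee_fin.
  move=> j _; have := Hj j; rewrite error_run; case: ifP => _.
    by rewrite andbT -leNgt.
  by rewrite lee_fin.
move=> /existsP[j /andP[aj mj]]; apply: (lt_le_trans aj).
have := error_run x i j; rewrite mj => <-.
exact: (le_bigmax _ (fun j => error D (run (a := A) (label c x) i j) (c j))).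
Qed.

Lemma measurable_failure alpha : 0 <= alpha -> measurable (failure (A := A) alpha D c).
Proof.
move=> alpha0; rewrite failureE//.
(* Coins are naturals, so the event is a countable union of rectangles, indexed by coin values and
   heavy targets. *)
rewrite (_ : mkset _ = \bigcup_i \bigcup_(j in [set j | (alpha%:E < D [set z j])%E])
    ([set x | missed x i j] `*` [set i])); last first.
  apply/seteqP; split => -[x i] /=.
    by move=> /existsP[j /andP[aj mj]]; exists i => //; exists j.
  by move=> [i' _ [j aj [/= mj ->]]]; apply/existsP; exists j; rewrite aj.
apply: bigcupT_measurable => i; apply: fin_bigcup_measurable => [|j _].
  exact: finite_finset.
apply: measurableX => //; apply: (measurable_occurrences measurable_singleton (z := z j)).
move=> x x' xx' /=; rewrite /missed.
rewrite (mem_release_eq (g' := multiplicity (label c x')) (s' := label c x') _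
  (z' := bin (z j)))// ?binE//.
by rewrite !multiplicity_label !count_mem_map xx'.
Qed.

(** Union bound over the heavy points: one of count m > 0 is missed with probability 1 - p m. *)
Lemma law_missed_le r K alpha x : 0 <= K -> 0 <= r ->
    (forall i, (i <= n)%N -> 1 - p i <= K * r ^+ i) ->
  (coin_law A [set i | [exists j, (alpha%:E < D [set z j])%E && missed x i j]] <=
   (\sum_(y <- heavy alpha) K * r ^+ count_mem y x)%:E)%E.
Proof.
move=> K0 r0 pr; pose S := label c x.
rewrite (histogram_lawE p0 p_mono p_le1 S
  [set L : seq (X * k.-tuple bool) | [exists j, (alpha%:E < D [set z j])%E && (bin (z j) \notin L)]]).
rewrite lee_fin.
apply: (@le_trans _ _ (sublist_mean (p \o multiplicity S) (undup S)
    (fun L => \sum_(y <- heavy alpha) (bin y \notin L)%:R))).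
  apply: sublist_mean_le => [b|L]; first exact: p01.
  case: asboolP => [/existsP[j /andP[aj jL]]|_]; last exact: sumr_ge0.
  rewrite (big_rem (z j)) /=; last first.
    by rewrite mem_undup; apply: map_f; rewrite mem_filter aj mem_enum.
  by rewrite jL lerDl sumr_ge0.
rewrite sublist_mean_sum; apply: ler_sum => y _.
rewrite sublist_mean_notin ?undup_uniq// mem_undup -multiplicity_label.
case: ifPn => [_|yS]; first by apply: pr; exact: multiplicity_le.
(* A point absent from the sample is always missed; the hypothesis at 0 reads 1 <= K, which covers
   this case. *)
have := pr 0 (leq0n _); rewrite p0 subr0 expr0 mulr1.
by rewrite /multiplicity (count_memPn yS) expr0 mulr1.
Qed.

Lemma heavyP alpha y : y \in heavy alpha -> (alpha%:E < D [set y])%E.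
Proof. by rewrite mem_undup => /mapP[j]; rewrite mem_filter => /andP[? _] ->. Qed.

Lemma heavy_size alpha : (size (heavy alpha))%:R * alpha <= 1.
Proof.
have -> : (size (heavy alpha))%:R * alpha = \sum_(y <- heavy alpha) alpha.
  by rewrite big_const_seq count_predT iter_addr addr0 mulr_natl.
have uZ : uniq (heavy alpha) by exact: undup_uniq.
rewrite -lee_fin -sumEFin.
apply: le_trans (sum_probability_singletons measurable_singleton D uZ).
by rewrite big_seq [leRHS]big_seq; apply: lee_sum => y /heavyP /ltW.
Qed.

(** Integrating the union bound over the sample gives one power of 1 - (1 - r) D{y} per heavy point.
    Quantifying over [m] keeps [D] out of the hypotheses. *)
Lemma failure_le alpha r K beta : 0 < alpha -> 0 <= r <= 1 -> 0 <= K ->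
    (forall i, (i <= n)%N -> 1 - p i <= K * r ^+ i) ->
    (forall m : nat, m%:R * alpha <= 1 ->
       m%:R * (K * (1 - (1 - r) * alpha) ^+ n) <= beta) ->
  ((iid D n \x coin_law A) (failure (A := A) alpha D c) <= beta%:E)%E.
Proof.
move=> alpha0 /andP[r0 r1] K0 pr m_le.
have mf := measurable_failure (ltW alpha0).
have mF y := @measurable_count _ _ R measurable_singleton n y (fun i => (K * r ^+ i)%:E).
have mG y := @measurable_count _ _ R measurable_singleton n y (fun i => (r ^+ i)%:E).
have F0 y (x : n.-tuple X) : (0 <= (K * r ^+ count_mem y x)%:E)%E.
  by rewrite lee_fin mulr_ge0// exprn_ge0.
apply: (@le_trans _ _ (\int[iid D n]_x (\sum_(y <- heavy alpha) (K * r ^+ count_mem y x)%:E))%E).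
  rewrite /= /product_measure1; apply: ge0_le_integral => //=.
  - exact: (measurable_fun_xsection (coin_law A) mf).
  - by apply: emeasurable_sum => y; exact: mF.
  move=> x _; rewrite failureE ?(ltW alpha0)// xsectionE sumEFin.
  exact: law_missed_le.
rewrite ge0_integral_sum//=.
apply: (@le_trans _ _ (\sum_(y <- heavy alpha) (K * (1 - (1 - r) * alpha) ^+ n)%:E)%E).
  rewrite big_seq [leRHS]big_seq; apply: lee_sum => y /heavyP yheavy.
  under eq_integral do rewrite EFinM.
  rewrite ge0_integralZl//=; last first.
    by move=> x _; rewrite lee_fin exprn_ge0.
  rewrite integral_power_occurrences ?r0// -EFinM lee_fin ler_wpM2l//.
  have Dy : (D [set y] <= 1)%E by exact: probability_le1.
  have yfin : D [set y] \is a fin_num by exact: fin_num_measure.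
  rewrite -(fineK yfin) lee_fin in Dy; rewrite -(fineK yfin) lte_fin in yheavy.
  by apply: lerXn2r; rewrite ?nnegrE; nra.
rewrite sumEFin lee_fin big_const_seq count_predT iter_addr addr0 -mulr_natl.
exact/m_le/heavy_size.
Qed.

End accuracy.

Lemma histogram_PAC d (X : measurableType d) (R : realType) (n k : nat)
    (mX : forall x : X, measurable [set x]) (p : nat -> R) (p0 : p 0 = 0)
    (p_mono : {homo p : i j / (i <= j)%N >-> i <= j}) (p_le1 : forall i, p i <= 1)
    (alpha beta r K : R) :
    0 < alpha -> 0 <= r <= 1 -> 0 <= K ->
    (forall i, (i <= n)%N -> 1 - p i <= K * r ^+ i) ->
    (forall m : nat, m%:R * alpha <= 1 ->
       m%:R * (K * (1 - (1 - r) * alpha) ^+ n) <= beta) ->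
  PAC_learner (@POINT d X) (histogram n k mX p0 p_mono p_le1) alpha beta.
Proof.
move=> alpha0 r01 K0 pr m_le D c cP.
have [z zc] := choice cP.
have -> : c = fun j y => y == z j by apply/funext.
split; first by apply: measurable_failure; exact: ltW.
exact: (failure_le mX p0 p_mono p_le1 D z alpha0 r01 K0 pr m_le).
Qed.

(** * Logistic release probabilities *)

Section logistic.
Context (R : realType) (r rho K : R).
Hypotheses (rho_ge1 : 1 <= rho) (r_gt0 : 0 < r) (r_rho : r * rho = 1) (K_gt0 : 0 < K).

(* A logistic curve in i, cut off at 0 so that bins outside the database are
   never released. *)
Definition logistic (i : nat) : R := if i is 0 then 0 else (1 + K * r ^+ i)^-1.

Let u i := K * r ^+ i.
Let u_gt0 i : 0 < u i. Proof. by rewrite mulr_gt0// exprn_gt0. Qed.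
Let uS i : u i.+1 * rho = u i.
Proof. by rewrite /u exprSr -!mulrA r_rho mulr1. Qed.

Let logisticE i : logistic i.+1 * (1 + u i.+1) = 1.
Proof. by rewrite /= mulVf// gt_eqF// addr_gt0// u_gt0. Qed.

Lemma logistic_ge0 i : 0 <= logistic i.
Proof. by case: i => // i; rewrite /= invr_ge0 ltW// addr_gt0// u_gt0. Qed.

Lemma logistic_le1 i : logistic i <= 1.
Proof.
case: i => [|i]; first exact: ler01.
have := logisticE i; have := logistic_ge0 i.+1; have := u_gt0 i.+1; nra.
Qed.

Lemma logistic_mono : {homo logistic : i j / (i <= j)%N >-> i <= j}.
Proof.
apply: homo_leq => [//|x y z|[|i]]; first exact: le_trans; first exact: logistic_ge0.
rewrite /= lef_pV2 ?posrE ?addr_gt0 ?u_gt0// lerD2l -/(u _) -/(u i.+1) -(uS i.+1).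
by rewrite ler_peMr// ltW.
Qed.

(** The cutoff at 0 is paid by delta. Beyond it, one more count multiplies the odds 1/u of release
    by rho, so the probability grows by at most that factor. *)
Lemma logistic_ratio delta i : logistic 1 <= delta ->
  logistic i.+1 <= rho * logistic i + delta.
Proof.
move=> d1; case: i => [|i]; first by rewrite mulr0 add0r.
have d0 : 0 <= delta by apply: le_trans d1; exact: logistic_ge0.
suff : logistic i.+2 <= rho * logistic i.+1 by lra.
have v0 : 0 < 1 + u i.+1 by rewrite addr_gt0 ?ltr01 ?u_gt0.
rewrite -(ler_pM2r v0) -mulrA logisticE mulr1 -uS.
have -> : logistic i.+2 * (1 + u i.+2 * rho) =
    rho * (logistic i.+2 * (1 + u i.+2)) - logistic i.+2 * (rho - 1) by ring.
by rewrite logisticE mulr1 gerBl mulr_ge0 ?logistic_ge0// subr_ge0.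
Qed.

(** For positive counts 1 - p = p u, where [u] drops by the factor rho while p increases; delta
    again pays for the step from 0. *)
Lemma logistic_ratioC delta i : logistic 1 <= delta ->
  1 - logistic i <= rho * (1 - logistic i.+1) + delta.
Proof.
move=> d1; case: i => [|i].
  have a1 : 0 <= 1 - logistic 1 by rewrite subr_ge0 logistic_le1.
  by have := ler_wpM2r a1 rho_ge1; rewrite [logistic 0]/=; lra.
have d0 : 0 <= delta by apply: le_trans d1; exact: logistic_ge0.
suff : 1 - logistic i.+1 <= rho * (1 - logistic i.+2) by lra.
have -> : 1 - logistic i.+1 = logistic i.+1 * u i.+1.
  by rewrite -{1}(logisticE i); ring.
have -> : 1 - logistic i.+2 = logistic i.+2 * u i.+2.
  by rewrite -{1}(logisticE i.+1); ring.
by rewrite -(uS i.+1) [leRHS]mulrC -[leRHS]mulrA ler_wpM2r ?logistic_mono// uS ltW.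
Qed.

Lemma logistic_tail i : 1 <= K -> 1 - logistic i <= K * r ^+ i.
Proof.
move=> K1; case: i => [|i]; first by rewrite subr0 expr0 mulr1.
have := logisticE i; have := u_gt0 i.+1; have := logistic_le1 i.+1.
rewrite -/(u i.+1); nra.
Qed.

End logistic.

(** * Choice of parameters *)

Theorem theorem3p13 (R : realType) :
  exists2 C : R, 0 < C &
  forall (d : measure_display) (X : measurableType d),
    (forall x : X, measurable [set x]) ->
  forall (k : nat) (alpha beta eps delta : R),
    0 < alpha < 1 -> 0 < beta < 1 -> 0 < eps <= 1 -> 0 < delta < 1 ->
  exists2 n : nat, (n%:Z <= sample_bound C alpha beta eps delta)%R &
  exists A : algorithm X R n k,
    differentially_private A eps delta /\
    PAC_learner (@POINT d X) A alpha beta.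
Proof.
(* 24 = 6 * 4: the failure bound uses the sixth power of [w], and 1 - r is bounded below by eps /
   4. *)
exists 24; first by lra.
move=> d X mX k alpha beta eps delta /andP[al0 al1] /andP[be0 be1] /andP[ep0 ep1].
move=> /andP[de0 de1]; rewrite /sample_bound.
pose w := alpha * beta * delta; rewrite -/w.
have ab0 : 0 < alpha * beta by rewrite mulr_gt0.
have ab1 : alpha * beta < 1 by nra.
have w0 : 0 < w by rewrite mulr_gt0.
have w1 : w < 1 by rewrite /w; nra.
pose s := ln w^-1; rewrite -/s.
have s0 : 0 < s by rewrite ln_gt0// invf_gt1.
have sE : expR (- s) = w by rewrite expRN lnK ?invrK// posrE invr_gt0.
have bound0 : 0 < 24 * ((alpha * eps)^-1 * s).
  by rewrite !mulr_gt0// invr_gt0 mulr_gt0.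
(* Up to 2/3 one has 6 w^5 <= 1, used in the second case; above it, alpha, beta and delta all exceed
   2/3. *)
have [w23|w23] := leP w (2 / 3); last first.
  exists 1; first by rewrite -gtz0_ge1 Num.Theory.ceil_gt0.
  have p_mono : {homo (fun i : nat => if i is 0 then 0 else delta) : i j / (i <= j)%N >-> i <= j}.
    by move=> [|i] [|j] //= _; exact: ltW.
  have p_le1 (i : nat) : (if i is 0 then 0 else delta) <= 1.
    by case: i => [|i]; [exact: ler01|exact: ltW].
  exists (histogram 1 k mX (erefl : (fun i : nat => if i is 0 then 0 else delta) 0 = 0) p_mono p_le1); split.
    by apply: histogram_private1 => //; exact: ltW.
  apply: (@histogram_PAC _ _ _ _ _ _ _ _ _ _ _ _ (1 - delta) 1) => //; first by lra.
    by case=> [|[|//]] _; rewrite ?expr0 ?expr1; lra.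
  (* Since 2 alpha > 1 there is at most one heavy point, missed with probability at most 1 - alpha
     delta < 1/3 < beta. *)
  move=> m; rewrite mul1r expr1 opprB addrCA subrr addr0.
  case: m => [|[|m]] ma; first by rewrite mul0r ltW.
    by rewrite mul1r; rewrite /w in w23; nra.
  have m2 : (2 : R) <= m.+2%:R by rewrite ler_nat.
  have := ler_wpM2r (ltW al0) m2.
  by rewrite /w in w23; nra.
set N := Num.ceil _.
have N0 : 0 <= N by rewrite ltW// Num.Theory.ceil_gt0.
exists `|N|%N; first by rewrite gez0_abs.
set n := `|N|%N.
(* Gives failure probability at most (K / alpha) w^6, and a factor 6 w^5 <= 1
   absorbs the constant in K <= 6 / delta. *)
have nE : 24 * s <= n%:R * (alpha * eps).
  rewrite -ler_pdivrMr ?mulr_gt0//.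
  have -> : n%:R = N%:~R :> R by rewrite -(gez0_abs N0).
  by apply: le_trans (Num.Theory.ceil_ge _); rewrite mulrA mulrAC.
(* The rate eps / 2 leaves exp eps for two count changes, and [K] makes K r = 3 / delta, so that a
   count of 1 is released with probability below delta / 3. *)
pose rho := expR (eps / 2); pose r := expR (- (eps / 2)); pose K := 3 * rho / delta.
have r_rho : r * rho = 1 by rewrite /r /rho mulrC expRxMexpNx_1.
have rho_ge : 1 + eps / 2 <= rho by exact: expR_ge1Dx.
have r_ge : 1 - eps / 2 <= r by exact: expR_ge1Dx.
have rho_ge1 : 1 <= rho by lra.
have r_gt0 : 0 < r by exact: expR_gt0.
have rho_le2 : rho <= 2 by nra.
(* 1 - r = r (rho - 1), with r >= 1/2 and rho - 1 >= eps / 2. *)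
have r_le : eps / 4 <= 1 - r by nra.
have KE : K * delta = 3 * rho by rewrite /K divfK// gt_eqF.
have K_gt0 : 0 < K by rewrite divr_gt0// mulr_gt0// expR_gt0.
have K_ge1 : 1 <= K by nra.
have log1 : logistic r K 1 <= delta / 3.
  rewrite /= expr1 -[leRHS]invf_div lef_pV2 ?posrE ?addr_gt0 ?mulr_gt0 ?invr_gt0//; last exact: expR_gt0.
  have -> : K * r = 3 / delta by rewrite /K mulrAC -[3 * rho * r]mulrA (mulrC rho r) r_rho mulr1.
  lra.
have m_le (m : nat) : m%:R * alpha <= 1 ->
    m%:R * (K * (1 - (1 - r) * alpha) ^+ n) <= beta.
  move=> ma.
  have x_le : (1 - (1 - r) * alpha) ^+ n <= w ^+ 6.
    apply: (@le_trans _ _ (expR (- ((1 - r) * alpha)) ^+ n)).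
      by rewrite lerXn2r ?nnegrE ?expR_ge0 ?expR_ge1Dx//; nra.
    rewrite -sE -!expRM_natl ler_expR.
    have : n%:R * (alpha * eps) <= n%:R * (alpha * (4 * (1 - r))).
      by rewrite ler_wpM2l// ler_wpM2l; lra.
    lra.
  have w6 : 6 * w ^+ 6 <= w.
    have w5 : w ^+ 5 <= (2 / 3) ^+ 5 by rewrite lerXn2r ?nnegrE//; lra.
    by rewrite exprSr mulrA ler_piMl ?ltW//; lra.
  (* The extra factor [w] pairs alpha with m and delta with K: m alpha <= 1 and K delta = 3 rho <=
     6. *)
  have mK : m%:R * K * w ^+ 6 * w <= w * beta.
    have -> : m%:R * K * w ^+ 6 * w = (m%:R * alpha) * (K * delta) * beta * w ^+ 6.
      by rewrite /w; ring.
    have m6 : m%:R * alpha * (K * delta) <= 6.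
      have : 0 <= m%:R * alpha by rewrite mulr_ge0// ltW.
      rewrite KE; nra.
    have bw : 0 <= beta * w ^+ 6 by rewrite mulr_ge0 ?exprn_ge0 ?ltW.
    have := ler_wpM2r bw m6; have := ler_wpM2l (ltW be0) w6; lra.
  have mK0 : 0 <= m%:R * K by rewrite mulr_ge0// ltW.
  rewrite mulrA; apply: le_trans (ler_wpM2l mK0 x_le) _.
  by rewrite -(ler_pM2r w0) [leRHS]mulrC.
have p0 : logistic r K 0 = 0 by [].
have p_mono := logistic_mono rho_ge1 r_gt0 r_rho K_gt0.
have p_le1 := logistic_le1 r_gt0 K_gt0.
exists (histogram n k mX p0 p_mono p_le1); split.
  (* Since rho <= 2, a loss of delta / 3 per count change gives (1 + rho) delta / 3 <= delta. *)
  apply: (@histogram_private _ _ _ _ _ _ _ _ _ _ rho (delta / 3)) => //.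
  - lra.
  - by move=> i; exact: logistic_ratio.
  - by move=> i; exact: logistic_ratioC.
  - by rewrite -expRD -splitr.
  - nra.
have r01 : 0 <= r <= 1 by lra.
apply: (histogram_PAC _ _ _ _ al0 r01 (ltW K_gt0) _ m_le).
by move=> i _; exact: logistic_tail.
Qed.
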